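(* The complete first-order theory of the structure $\mathbb{D}=([0,1[,+_1,-_1,0,<)$ in the language $L=\{+,-,0,<\}$ admits quantifier elimination.
   Context: $+_1$ is addition modulo $1$ on $[0,1[$, $-_1$ the corresponding negation (so $-_1x=1-x$ for $x\neq0$ and $-_10=0$), and $<$ the order induced from $\mathbb{R}$; the symbols $+,-,0,<$ are interpreted by $+_1,-_1,0,<$. *)

(* Defs.v *)
From HB Require Import structures.
From mathcomp Require Import all_boot all_order all_algebra.
From mathcomp Require Import reals.
From mathcomp Require Import lra.

Set Implicit Arguments.
Unset Strict Implicit.
Unset Printing Implicit Defensive.

Import Order.TTheory GRing.Theory Num.Theory.
Local Open Scope ring_scope.

(** First-order logic with equality in the language L = {+, -, 0, <}, where
    "-" is unary. [term n] and [formula n] have their free variables among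
    n variables, indexed by 'I_n. *)

Inductive term (n : nat) : Type :=
| TVar of 'I_n
| TZero
| TOpp of term n
| TAdd of term n & term n.

Arguments TZero {n}.

(** Under a quantifier the bound variable has index [ord0], and the variable
    of index [i] outside has index [lift ord0 i] inside. *)
Inductive formula : nat -> Type :=
| FEq n of term n & term n : formula n
| FLt n of term n & term n : formula n
| FNot n of formula n : formula n
| FAnd n of formula n & formula n : formula n
| FOr n of formula n & formula n : formula n
| FImp n of formula n & formula n : formula n
| FForall n of formula n.+1 : formula n
| FExists n of formula n.+1 : formula n.

Definition FIff n (phi psi : formula n) : formula n :=
  FAnd (FImp phi psi) (FImp psi phi).

Fixpoint quantifier_free n (phi : formula n) : Prop :=
  match phi with
  | FEq _ _ _ | FLt _ _ _ => True
  | FNot _ p => quantifier_free p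
  | FAnd _ p q | FOr _ p q | FImp _ p q =>
      quantifier_free p /\ quantifier_free q
  | FForall _ _ | FExists _ _ => False
  end.

Definition sentence : Type := formula 0.

Fixpoint universal_closure n : formula n -> sentence :=
  match n with
  | 0 => fun phi => phi
  | m.+1 => fun phi => universal_closure (FForall phi)
  end.

Record L_structure := LStructure {
  carrier :> Type;
  s_zero : carrier;
  s_opp : carrier -> carrier;
  s_add : carrier -> carrier -> carrier;
  s_lt : carrier -> carrier -> Prop
}.

Section Semantics.
Variable M : L_structure.

Definition extend n (a : M) (v : 'I_n -> M) (i : 'I_n.+1) : M :=
  if unlift ord0 i is Some j then v j else a.

Fixpoint eval n (v : 'I_n -> M) (t : term n) : M :=
  match t with
  | TVar i => v i
  | TZero => s_zero M
  | TOpp t1 => s_opp (eval v t1)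
  | TAdd t1 t2 => s_add (eval v t1) (eval v t2)
  end.

Fixpoint satisfies n (phi : formula n) : ('I_n -> M) -> Prop :=
  match phi in formula n return ('I_n -> M) -> Prop with
  | FEq _ t1 t2 => fun v => eval v t1 = eval v t2
  | FLt _ t1 t2 => fun v => s_lt (eval v t1) (eval v t2)
  | FNot _ p => fun v => ~ satisfies p v
  | FAnd _ p q => fun v => satisfies p v /\ satisfies q v
  | FOr _ p q => fun v => satisfies p v \/ satisfies q v
  | FImp _ p q => fun v => satisfies p v -> satisfies q v
  | FForall _ p => fun v => forall a : M, satisfies p (extend a v)
  | FExists _ p => fun v => exists a : M, satisfies p (extend a v)
  end.

Definition holds (s : sentence) : Prop := forall v : 'I_0 -> M, satisfies s v.

End Semantics.

Definition theory : Type := sentence -> Prop.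

Definition complete_theory (M : L_structure) : theory := fun s => holds M s.

Definition is_model (M : L_structure) (T : theory) : Prop :=
  forall s, T s -> holds M s.

Definition entails (T : theory) (s : sentence) : Prop :=
  forall M : L_structure, is_model M T -> holds M s.

(** The case n = 0 is included: since L has a constant symbol, there are
    quantifier-free sentences. *)
Definition admits_QE (T : theory) : Prop :=
  forall (n : nat) (phi : formula n),
    exists psi : formula n,
      quantifier_free psi /\ entails T (universal_closure (FIff phi psi)).

Section StructureD.
Variable R : realType.

Definition Dcarrier : Type := {x : R | 0 <= x < 1}.

Lemma Dzero_subproof : 0 <= (0 : R) < 1.
Proof. by rewrite lexx ltr01. Qed.

Definition Dzero : Dcarrier := exist _ 0 Dzero_subproof.

Definition opp1 (x : R) : R := if x == 0 then 0 else 1 - x.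

Lemma Dopp_subproof (x : Dcarrier) : 0 <= opp1 (sval x) < 1.
Proof.
case: x => x /= /andP[x0 x1]; rewrite /opp1; case: eqVneq => [_|xN0].
  by rewrite lexx ltr01.
have {}x0 : 0 < x by rewrite lt_def xN0.
by apply/andP; split; lra.
Qed.

Definition Dopp (x : Dcarrier) : Dcarrier :=
  exist _ (opp1 (sval x)) (Dopp_subproof x).

Definition add1 (x y : R) : R := if x + y < 1 then x + y else x + y - 1.

Lemma Dadd_subproof (x y : Dcarrier) : 0 <= add1 (sval x) (sval y) < 1.
Proof.
case: x y => [x /= /andP[x0 x1]] [y /= /andP[y0 y1]]; rewrite /add1.
by case: ltP => xy; apply/andP; split; lra.
Qed.

Definition Dadd (x y : Dcarrier) : Dcarrier :=
  exist _ (add1 (sval x) (sval y)) (Dadd_subproof x y).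

Definition Dlt (x y : Dcarrier) : Prop := sval x < sval y.

Definition D : L_structure := LStructure Dzero Dopp Dadd Dlt.

End StructureD.

(* Main.v *)
(** On the unit cube, first-order formulas over D define exactly the finite
    Boolean combinations of affine inequalities with integer coefficients.
    Every term equals an affine form minus its integer part, which takes
    finitely many values, so atomic formulas are semilinear, and
    Fourier-Motzkin elimination handles the quantifiers.  Conversely the
    integer part of an affine form can be traced by quantifier-free formulas:
    in an addition modulo 1 of [x] to [t] a carry occurs iff the result is
    smaller than [t], and in a subtraction iff [t] is smaller than [x]. *)
Require Import Defs.
From mathcomp Require Import all_boot all_order all_algebra.
From mathcomp Require Import reals.
From mathcomp Require Import ring lra.

Set Implicit Arguments.
Unset Strict Implicit.
Unset Printing Implicit Defensive.

Import Order.TTheory GRing.Theory Num.Theory.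
Local Open Scope ring_scope.

(** * Affine forms with integer coefficients *)

Section AffineForms.
Variable R : realFieldType.

(** Coefficients form a finite function, so that equality of forms is decidable and membership in
    lists of constraints makes sense. *)
Definition affine (n : nat) : eqType := ({ffun 'I_n -> int} * int)%type.

Definition aff_eval n (f : affine n) (x : 'I_n -> R) : R :=
  \sum_i x i *~ f.1 i + f.2%:~R.

Definition aff_const n (c : int) : affine n := ([ffun => 0], c).
Definition aff_var n (j : 'I_n) : affine n := ([ffun i => (i == j)%:Z], 0).
Definition aff_add n (f g : affine n) : affine n :=
  ([ffun i => f.1 i + g.1 i], f.2 + g.2).
Definition aff_scale n (k : int) (f : affine n) : affine n :=
  ([ffun i => f.1 i * k], f.2 * k).
Definition aff_sub n (f g : affine n) : affine n := aff_add f (aff_scale (-1) g).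

Lemma aff_eval_ext n (f : affine n) (x y : 'I_n -> R) :
  x =1 y -> aff_eval f x = aff_eval f y.
Proof. by move=> e; congr (_ + _); apply: eq_bigr => i _; rewrite e. Qed.

Lemma aff_eval_const n c (x : 'I_n -> R) : aff_eval (aff_const n c) x = c%:~R.
Proof. by rewrite /aff_eval big1 ?add0r // => i _; rewrite ffunE mulr0z. Qed.

Lemma aff_eval_var n j (x : 'I_n -> R) : aff_eval (aff_var j) x = x j.
Proof.
rewrite /aff_eval (bigD1 j) //= big1 ?ffunE ?eqxx ?addr0 ?mulr1z //.
by move=> i /negbTE ij; rewrite ffunE ij mulr0z.
Qed.

Lemma aff_eval_add n (f g : affine n) (x : 'I_n -> R) :
  aff_eval (aff_add f g) x = aff_eval f x + aff_eval g x.
Proof.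
rewrite /aff_eval /= intrD addrACA -big_split /=.
by congr (_ + _); apply: eq_bigr => i _; rewrite ffunE mulrzDr.
Qed.

Lemma aff_eval_scale n k (f : affine n) (x : 'I_n -> R) :
  aff_eval (aff_scale k f) x = k%:~R * aff_eval f x.
Proof.
rewrite /aff_eval /= intrM mulrDr (mulrC k%:~R f.2%:~R) mulr_sumr.
congr (_ + _); apply: eq_bigr => i _.
by rewrite ffunE mulrzA mulrC mulrzr.
Qed.

Lemma aff_eval_sub n (f g : affine n) (x : 'I_n -> R) :
  aff_eval (aff_sub f g) x = aff_eval f x - aff_eval g x.
Proof. by rewrite aff_eval_add aff_eval_scale mulN1r. Qed.

Definition cons_val n (y : R) (x : 'I_n -> R) (i : 'I_n.+1) : R :=
  if unlift ord0 i is Some j then x j else y.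

Definition aff_tail n (f : affine n.+1) : affine n :=
  ([ffun i => f.1 (lift ord0 i)], f.2).

Lemma aff_eval_cons n (f : affine n.+1) y (x : 'I_n -> R) :
  aff_eval f (cons_val y x) = y * (f.1 ord0)%:~R + aff_eval (aff_tail f) x.
Proof.
rewrite /aff_eval big_ord_recl /cons_val unlift_none mulrzr -addrA.
by congr (_ + (_ + _)); apply: eq_bigr => i _; rewrite liftK ffunE.
Qed.

End AffineForms.

(** * Semilinear sets and their Boolean closure *)

Section SemilinearSets.
Variable R : realFieldType.

Definition positive (strict : bool) (z : R) : bool :=
  if strict then 0 < z else 0 <= z.

Definition constraint (n : nat) : eqType := (bool * affine n)%type.

Definition csat n (x : 'I_n -> R) (p : constraint n) : bool :=
  positive p.1 (aff_eval p.2 x).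

(** A disjunctive normal form: a finite union of polyhedra whose faces may be open or closed. An
    equality is expressed by two opposite weak inequalities. *)
Definition semilinear n (P : ('I_n -> R) -> bool) : Prop :=
  exists ls : seq (seq (constraint n)), forall x, P x = has (all (csat x)) ls.

Lemma csat_ext n (x y : 'I_n -> R) : x =1 y -> csat x =1 csat y.
Proof. by move=> e p; rewrite /csat (aff_eval_ext _ e). Qed.

Lemma semilinear_ext n (P Q : ('I_n -> R) -> bool) :
  P =1 Q -> semilinear P -> semilinear Q.
Proof. by move=> e [ls h]; exists ls => x; rewrite -e. Qed.

(** This stands in for functional extensionality: extending a valuation over [D] and over [R] gives
    functions that agree only pointwise. *)
Lemma semilinear_val n (P : ('I_n -> R) -> bool) x y :
  semilinear P -> x =1 y -> P x = P y.
Proof.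
by move=> [ls h] e; rewrite !h; apply: eq_has => s; apply: eq_all; apply: csat_ext.
Qed.

Lemma semilinear_atom n s (f : affine n) :
  semilinear (fun x => positive s (aff_eval f x)).
Proof. by exists [:: [:: (s, f)]] => x; rewrite /= andbT orbF. Qed.

Lemma semilinear_false n : semilinear (fun _ : 'I_n -> R => false).
Proof. by exists [::]. Qed.

Lemma semilinear_true n : semilinear (fun _ : 'I_n -> R => true).
Proof. by exists [:: [::]]. Qed.

Lemma semilinear_or n (P Q : ('I_n -> R) -> bool) :
  semilinear P -> semilinear Q -> semilinear (fun x => P x || Q x).
Proof. by move=> [l1 h1] [l2 h2]; exists (l1 ++ l2) => x; rewrite has_cat h1 h2. Qed.

Lemma semilinear_and n (P Q : ('I_n -> R) -> bool) :
  semilinear P -> semilinear Q -> semilinear (fun x => P x && Q x).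
Proof.
move=> [l1 h1] [l2 h2]; exists [seq a ++ b | a <- l1, b <- l2] => x.
rewrite h1 h2; apply/andP/hasP.
  move=> [/hasP[a al ha] /hasP[b bl hb]]; exists (a ++ b).
    by apply: allpairs_f.
  by rewrite all_cat ha hb.
move=> [_ /allpairsP[[a b] [/= al bl ->]]]; rewrite all_cat => /andP[ha hb].
by split; apply/hasP; [exists a | exists b].
Qed.

Lemma semilinear_has n (T : Type) (P : T -> ('I_n -> R) -> bool) (s : seq T) :
  (forall i, semilinear (P i)) -> semilinear (fun x => has (P^~ x) s).
Proof.
move=> h; elim: s => [|i s ih] /=; first exact: semilinear_false.
exact: semilinear_or.
Qed.

Lemma semilinear_all n (T : Type) (P : T -> ('I_n -> R) -> bool) (s : seq T) :
  (forall i, semilinear (P i)) -> semilinear (fun x => all (P^~ x) s).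
Proof.
move=> h; elim: s => [|i s ih] /=; first exact: semilinear_true.
exact: semilinear_and.
Qed.

(** By De Morgan the complement is a conjunction of disjunctions of negated constraints. Negating a
    constraint changes the sign of its form and exchanges strict with weak, so it is again a
    constraint. *)
Lemma semilinear_not n (P : ('I_n -> R) -> bool) :
  semilinear P -> semilinear (fun x => ~~ P x).
Proof.
move=> [ls h].
apply: (@semilinear_ext _ (fun x =>
  all (fun l => has (fun p => ~~ csat x p) l) ls)) => [x|].
  by rewrite h -all_predC; apply: eq_all => l /=; rewrite -has_predC.
apply: (semilinear_all (P := fun l x => has (fun p => ~~ csat x p) l)) => l.
apply: (semilinear_has (P := fun p x => ~~ csat x p)) => -[s f].
apply: semilinear_ext (semilinear_atom (~~ s) (aff_scale (-1) f)) => x.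
by rewrite aff_eval_scale mulN1r /csat /positive; case: s; rewrite /= ?oppr_ge0
  ?oppr_gt0 -?leNgt -?ltNge.
Qed.

(** This provides the tightest bound in a list. Comparing bounds by implication, not by value, also
    settles ties between strict and weak ones. The induction keeps the stronger of the head and the
    strongest element of the tail. *)
Lemma ex_strongest (T : eqType) (X : Type) (sat : X -> pred T) (a : T) s :
  {in a :: s &, forall p q,
    (forall y, sat y p -> sat y q) \/ (forall y, sat y q -> sat y p)} ->
  exists2 p, p \in a :: s & forall y, sat y p -> all (sat y) (a :: s).
Proof.
elim: s a => [|b s ih] a h.
  by exists a; rewrite ?mem_head // => y /= ->.
have [p ps hp] : exists2 p, p \in b :: s & forall y, sat y p -> all (sat y) (b :: s).
  by apply: ih => p q ps qs; apply: h; rewrite inE ?ps ?qs orbT.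
have pas : p \in [:: a, b & s] by rewrite inE ps orbT.
case: (h p a pas (mem_head _ _)) => e.
  by exists p => // y py; rewrite /= -/(all _ (b :: s)) e // hp.
exists a; first exact: mem_head.
by move=> y ay; rewrite /= ay; apply/hp/e.
Qed.

(** * Fourier-Motzkin elimination of one variable *)

Section FourierMotzkin.
Variable n : nat.
Implicit Types (p q : constraint n.+1) (x : 'I_n -> R).

Definition coef0 p : int := p.2.1 ord0.

(** For a lower bound [p] and an upper bound [q] this is the combination of both, with positive
    weights [- coef0 q] and [coef0 p], in which the eliminated variable cancels. It is strict as
    soon as one of the two is. *)
Definition resolvent p q : constraint n :=
  (p.1 || q.1, aff_sub (aff_scale (coef0 p) (aff_tail q.2))
                       (aff_scale (coef0 q) (aff_tail p.2))).

Definition lowers (L : seq (constraint n.+1)) := [seq p <- L | 0 < coef0 p].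
Definition uppers (L : seq (constraint n.+1)) := [seq p <- L | coef0 p < 0].

Definition eliminate L : seq (constraint n) :=
  [seq (p.1, aff_tail p.2) | p <- L & coef0 p == 0] ++
  [seq resolvent p q | p <- lowers L, q <- uppers L].

(* The value of the bound that [p] puts on the eliminated variable. *)
Definition cbound x p : R := - aff_eval (aff_tail p.2) x / (coef0 p)%:~R.

Lemma csat_lower x y p : 0 < coef0 p ->
  csat (cons_val y x) p = positive p.1 (y - cbound x p).
Proof.
rewrite -(ltr0z R) => c0; rewrite /csat aff_eval_cons -/(coef0 p) /cbound.
have -> : y * (coef0 p)%:~R + aff_eval (aff_tail p.2) x =
    (y - - aff_eval (aff_tail p.2) x / (coef0 p)%:~R) * (coef0 p)%:~R.
  by rewrite mulrBl divfK ?opprK // gt_eqF.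
by rewrite /positive pmulr_lgt0 // pmulr_lge0.
Qed.

Lemma csat_upper x y p : coef0 p < 0 ->
  csat (cons_val y x) p = positive p.1 (cbound x p - y).
Proof.
rewrite -(ltrz0 R) => c0; rewrite /csat aff_eval_cons -/(coef0 p) /cbound.
have -> : y * (coef0 p)%:~R + aff_eval (aff_tail p.2) x =
    (- aff_eval (aff_tail p.2) x / (coef0 p)%:~R - y) * - (coef0 p)%:~R.
  by rewrite mulrN mulrBl divfK ?lt_eqF // opprB opprK.
by rewrite /positive pmulr_lgt0 ?oppr_gt0 // pmulr_lge0 ?oppr_gt0.
Qed.

Lemma csat_neutral x y p : coef0 p = 0 ->
  csat (cons_val y x) p = csat x (p.1, aff_tail p.2).
Proof. by move=> c0; rewrite /csat aff_eval_cons -/(coef0 p) c0 mulr0 add0r. Qed.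

Lemma csat_resolvent x p q : 0 < coef0 p -> coef0 q < 0 ->
  csat x (resolvent p q) = positive (p.1 || q.1) (cbound x q - cbound x p).
Proof.
rewrite -(ltr0z R) -(ltrz0 R) => p0 q0.
rewrite /csat /= aff_eval_sub !aff_eval_scale /cbound.
set a := (coef0 p)%:~R in p0 *; set b := (coef0 q)%:~R in q0 *.
set g := aff_eval _ x; set h := aff_eval _ x.
have -> : a * g - b * h = (- g / b - - h / a) * (a * - b).
  have aN0 : a != 0 by rewrite gt_eqF.
  have bN0 : b != 0 by rewrite lt_eqF.
  by field; rewrite aN0 bN0.
have ab : 0 < a * - b by rewrite mulr_gt0 // oppr_gt0.
by rewrite /positive pmulr_lgt0 // pmulr_lge0.
Qed.

(** The larger lower bound is the stronger one; at equal bounds a strict constraint implies a weak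
    one. *)
Lemma lowers_comparable x L : {in lowers L &, forall p q,
  (forall y, csat (cons_val y x) p -> csat (cons_val y x) q) \/
  (forall y, csat (cons_val y x) q -> csat (cons_val y x) p)}.
Proof.
move=> p q; rewrite !mem_filter => /andP[p0 _] /andP[q0 _].
have [pq|pq|pq] := ltgtP (cbound x p) (cbound x q); [right|left|].
- by move=> y; rewrite !csat_lower // /positive; case: p.1; case: q.1; lra.
- by move=> y; rewrite !csat_lower // /positive; case: p.1; case: q.1; lra.
- case: (boolP p.1) => hp; [left|right] => y;
  by rewrite !csat_lower // pq /positive ?hp ?(negbTE hp); case: q.1; lra.
Qed.

Lemma uppers_comparable x L : {in uppers L &, forall p q,
  (forall y, csat (cons_val y x) p -> csat (cons_val y x) q) \/
  (forall y, csat (cons_val y x) q -> csat (cons_val y x) p)}.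
Proof.
move=> p q; rewrite !mem_filter => /andP[p0 _] /andP[q0 _].
have [pq|pq|pq] := ltgtP (cbound x p) (cbound x q); [left|right|].
- by move=> y; rewrite !csat_upper // /positive; case: p.1; case: q.1; lra.
- by move=> y; rewrite !csat_upper // /positive; case: p.1; case: q.1; lra.
- case: (boolP p.1) => hp; [left|right] => y;
  by rewrite !csat_upper // pq /positive ?hp ?(negbTE hp); case: q.1; lra.
Qed.

(** For the direction from right to left, a lower and an upper bound on the same [y] imply their
    resolvent. For the converse, only the tightest lower and the tightest upper bound matter, and
    their resolvent says that there is room between them. *)
Lemma eliminateP x L : lowers L != [::] -> uppers L != [::] ->
  all (csat x) (eliminate L) <-> exists y, all (csat (cons_val y x)) L.
Proof.
move=> Ll Lu; rewrite all_cat all_map; split; last first.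
  move=> [y /allP h]; apply/andP; split.
    apply/allP => p; rewrite mem_filter => /andP[/eqP c0 pL].
    by rewrite /= -(csat_neutral x y c0) h.
  apply/allP => _ /allpairsP[[p q] [/= + + ->]].
  rewrite !mem_filter => /andP[p0 pL] /andP[q0 qL].
  have := h _ qL; have := h _ pL.
  rewrite csat_lower // csat_upper // csat_resolvent // /positive.
  by case: p.1; case: q.1 => /=; lra.
move=> /andP[/allP hN /allP hR].
have [p pL hp] : exists2 p, p \in lowers L &
    forall y, csat (cons_val y x) p -> all (csat (cons_val y x)) (lowers L).
  have := @lowers_comparable x L.
  case: (lowers L) Ll => // a s _ h.
  exact: (ex_strongest (sat := fun y => csat (cons_val y x))).
have [q qL hq] : exists2 q, q \in uppers L &
    forall y, csat (cons_val y x) q -> all (csat (cons_val y x)) (uppers L).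
  have := @uppers_comparable x L.
  case: (uppers L) Lu => // a s _ h.
  exact: (ex_strongest (sat := fun y => csat (cons_val y x))).
have p0 : 0 < coef0 p by move: pL; rewrite mem_filter => /andP[].
have q0 : coef0 q < 0 by move: qL; rewrite mem_filter => /andP[].
have /hR : resolvent p q \in [seq resolvent p q | p <- lowers L, q <- uppers L].
  exact: allpairs_f.
rewrite csat_resolvent // => pq.
(* The midpoint meets both bounds even when they coincide, since then the resolvent forces both to
   be weak. *)
pose y := (cbound x p + cbound x q) / 2.
have /hp/allP Hl : csat (cons_val y x) p.
  by rewrite csat_lower //; move: pq; rewrite /positive /y; case: p.1; case: q.1 => /=; lra.
have /hq/allP Hu : csat (cons_val y x) q.
  by rewrite csat_upper //; move: pq; rewrite /positive /y; case: p.1; case: q.1 => /=; lra.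
exists y; apply/allP => r rL; have [r0|r0|r0] := ltgtP (coef0 r) 0.
- by apply: Hu; rewrite mem_filter r0.
- by apply: Hl; rewrite mem_filter r0.
- by rewrite csat_neutral //; apply: (hN r); rewrite mem_filter r0 eqxx.
Qed.

(** The existential quantifier distributes over the disjunction, so each polyhedron is treated
    alone. Adding the constraints [0 <= y] and [y < 1] restricts the quantifier to the carrier and
    guarantees one lower and one upper bound. *)
Lemma semilinear_exists (P : ('I_n.+1 -> R) -> bool) : semilinear P ->
  exists2 Q : ('I_n -> R) -> bool, semilinear Q &
    forall x, Q x <-> exists2 y, 0 <= y < 1 & P (cons_val y x).
Proof.
move=> [ls h].
pose y0 : constraint n.+1 := (false, aff_var ord0).
pose y1 : constraint n.+1 := (true, aff_sub (aff_const _ 1) (aff_var ord0)).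
pose box L := [:: y0, y1 & L].
have boxE y x L : all (csat (cons_val y x)) (box L) =
    (0 <= y < 1) && all (csat (cons_val y x)) L.
  rewrite /= /csat /= aff_eval_sub aff_eval_var aff_eval_const /positive.
  by rewrite /cons_val unlift_none subr_gt0 andbA.
have Q L x : all (csat x) (eliminate (box L)) <->
    exists y, all (csat (cons_val y x)) (box L).
  have c0 : coef0 y0 = 1 by rewrite /coef0 ffunE eqxx.
  have c1 : coef0 y1 = -1 by rewrite /coef0 !ffunE eqxx.
  by apply: eliminateP; rewrite /lowers /uppers /= c0 c1.
exists (fun x => has (all (csat x)) [seq eliminate (box L) | L <- ls]).
  by exists [seq eliminate (box L) | L <- ls].
move=> x; rewrite has_map; split.
  move=> /hasP[L Ll /Q[y]]; rewrite boxE => /andP[y01 hL].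
  by exists y => //; rewrite h; apply/hasP; exists L.
move=> [y y01]; rewrite h => /hasP[L Ll hL].
by apply/hasP; exists L => //; apply/Q; exists y; rewrite boxE y01.
Qed.

End FourierMotzkin.
End SemilinearSets.

(** * From formulas over the structure to semilinear sets *)

Section DefinableSets.
Variable R : realType.
Local Notation D := (D R).

Definition vals n (v : 'I_n -> D) (i : 'I_n) : R := sval (v i).

Lemma D_bounds (a : D) : 0 <= sval a < 1.
Proof. exact: svalP a. Qed.

Lemma D_inj (a b : D) : sval a = sval b -> a = b.
Proof.
case: a b => [a ha] [b hb] /= e; subst b.
by congr (exist _ _ _); apply: bool_irrelevance.
Qed.

Lemma vals_extend n (a : D) (v : 'I_n -> D) :
  vals (extend a v) =1 cons_val (sval a) (vals v).
Proof. by move=> i; rewrite /vals /extend /cons_val; case: unlift. Qed.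

(** The integer [k] depends on the valuation, but the list [s] of its possible values does not: each
    operation negates or adds the integers already present, up to a shift by one when the result
    wraps around. *)
Lemma eval_affine n (t : term n) : exists (f : affine n) (s : seq int),
  forall v : 'I_n -> D, exists2 k, k \in s &
    sval (eval v t) = aff_eval f (vals v) - k%:~R.
Proof.
elim: t => [i||t [f [s h]]|t [f [s h]] u [g [r k]]].
- exists (aff_var i), [:: 0] => v; exists 0; rewrite ?mem_head //.
  by rewrite aff_eval_var subr0.
- exists (aff_const n 0), [:: 0] => v; exists 0; rewrite ?mem_head //.
  by rewrite aff_eval_const subr0.
- exists (aff_scale (-1) f), ([seq - k | k <- s] ++ [seq - k - 1 | k <- s]) => v.
  have [k ks e] := h v; rewrite aff_eval_scale mulN1r /= /opp1 e.
  case: eqP => e0.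
    by exists (- k); [rewrite mem_cat map_f | rewrite mulrNz; lra].
  exists (- k - 1); last by rewrite intrD !mulrNz; lra.
  by rewrite mem_cat orbC (map_f (fun k => - k - 1)).
- exists (aff_add f g), ([seq a + b | a <- s, b <- r] ++
                         [seq a + b + 1 | a <- s, b <- r]) => v.
  have [a ar ea] := h v; have [b bs eb] := k v.
  rewrite aff_eval_add /= /add1 ea eb; case: ifP => _.
    by exists (a + b); [rewrite mem_cat allpairs_f | rewrite intrD; lra].
  exists (a + b + 1); last by rewrite !intrD; lra.
  by rewrite mem_cat orbC (allpairs_f (fun a b => a + b + 1)).
Qed.

Lemma int_part_unique (z : R) (k l : int) :
  0 <= z - k%:~R < 1 -> 0 <= z - l%:~R < 1 -> k = l.
Proof.
move=> /andP[k0 k1] /andP[l0 l1]; apply/eqP; rewrite eq_le -!ltzD1.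
by rewrite -!(ltr_int R) !intrD; apply/andP; split; lra.
Qed.

Lemma semilinear_unit n (f : affine n) :
  semilinear (fun x : 'I_n -> R => 0 <= aff_eval f x < 1).
Proof.
apply: semilinear_and; first exact: (semilinear_atom _ false).
apply: semilinear_ext (semilinear_atom R true (aff_sub (aff_const n 1) f)) => x.
by rewrite /positive aff_eval_sub aff_eval_const subr_gt0.
Qed.

(** All pairs of candidate integer parts are tried. The right pair is the one that brings both
    affine forms into [0,1[, by uniqueness of the integer part, and for it the forms equal the
    terms. The relation is kept abstract to serve both equality and order. *)
Lemma semilinear_rel n (t u : term n) (r : rel R) :
  (forall f g : affine n,
    semilinear (fun x : 'I_n -> R => r (aff_eval f x) (aff_eval g x))) ->
  exists2 P, semilinear P &
    forall v : 'I_n -> D, P (vals v) = r (sval (eval v t)) (sval (eval v u)).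
Proof.
move=> hr; have [f [s hf]] := eval_affine t; have [g [s' hg]] := eval_affine u.
pose sub f (k : int) := aff_sub f (aff_const n k).
have subE h k x : aff_eval (sub h k) x = aff_eval h x - k%:~R :> R.
  by rewrite aff_eval_sub aff_eval_const.
exists (fun x => has (fun k => has (fun l =>
    (0 <= aff_eval (sub f k) x < 1) && (0 <= aff_eval (sub g l) x < 1) &&
    r (aff_eval (sub f k) x) (aff_eval (sub g l) x)) s') s).
  apply: (semilinear_has (P := fun k x => has _ s')) => k.
  apply: (semilinear_has (P := fun l x => _ && _)) => l.
  by do 2?[apply: semilinear_and] => //; apply: semilinear_unit.
move=> v; have [k ks ek] := hf v; have [l ls el] := hg v.
have := D_bounds (eval v t); have := D_bounds (eval v u); rewrite ek el => ul tk.
apply/hasP/idP.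
  move=> [k' _ /hasP[l' _]]; rewrite !subE => /andP[/andP[tk' ul']].
  by rewrite (int_part_unique tk tk') (int_part_unique ul ul').
by move=> h; exists k => //; apply/hasP; exists l => //; rewrite !subE tk ul.
Qed.

(** The describing predicate is boolean, so an implication can be turned into a disjunction and a
    universal quantifier into a negated existential one. *)
Lemma satisfies_semilinear n (phi : formula n) :
  exists2 P : ('I_n -> R) -> bool, semilinear P &
    forall v : 'I_n -> D, satisfies phi v <-> P (vals v).
Proof.
elim: phi => {n} [n t u|n t u|n p [P sP hP]|n p [P sP hP] q [Q sQ hQ]
  |n p [P sP hP] q [Q sQ hQ]|n p [P sP hP] q [Q sQ hQ]|n p [P sP hP]|n p [P sP hP]].
- have [f g|P sP h] := @semilinear_rel n t u (fun a b => a == b).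
    apply: semilinear_ext (semilinear_and
      (semilinear_atom R false (aff_sub f g)) (semilinear_atom R false (aff_sub g f))).
    by move=> x; rewrite !aff_eval_sub /positive !subr_ge0 andbC -eq_le.
  exists P => // v; rewrite h /=; split=> [->|/eqP]; first exact: eqxx.
  exact: D_inj.
- have [f g|P sP h] := @semilinear_rel n t u (fun a b => a < b).
    apply: semilinear_ext (semilinear_atom R true (aff_sub g f)).
    by move=> x; rewrite !aff_eval_sub /positive subr_gt0.
  by exists P => // v; rewrite h.
- exists (fun x => ~~ P x) => [|v /=]; first exact: semilinear_not.
  by rewrite hP; split=> /negP.
- exists (fun x => P x && Q x) => [|v /=]; first exact: semilinear_and.
  by rewrite hP hQ; split=> /andP.
- exists (fun x => P x || Q x) => [|v /=]; first exact: semilinear_or.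
  by rewrite hP hQ; split=> /orP.
- exists (fun x => ~~ P x || Q x) => [|v /=].
    exact: semilinear_or (semilinear_not sP) sQ.
  by rewrite hP hQ -implybE; split=> /implyP.
- have [Q sQ hQ] := semilinear_exists (semilinear_not sP).
  exists (fun x => ~~ Q x) => [|v /=]; first exact: semilinear_not.
  split=> [h|/negP h a].
    apply/negP => /hQ[y y01 /negP]; apply.
    by rewrite -(semilinear_val sP (vals_extend (exist _ y y01) v)); apply/hP/h.
  apply/hP/negP => /negP nP; apply/h/hQ; exists (sval a); first exact: D_bounds.
  by rewrite -(semilinear_val sP (vals_extend a v)).
- have [Q sQ hQ] := semilinear_exists sP; exists Q => // v /=; rewrite hQ; split.
    move=> [a /hP h]; exists (sval a); first exact: D_bounds.
    by rewrite -(semilinear_val sP (vals_extend a v)).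
  move=> [y y01 h]; exists (exist _ y y01); apply/hP.
  by rewrite (semilinear_val sP (vals_extend (exist _ y y01) v)).
Qed.

(** * From semilinear sets back to quantifier-free formulas *)

Definition qf_definable n (P : ('I_n -> D) -> Prop) : Prop :=
  exists2 psi : formula n, quantifier_free psi &
    forall v : 'I_n -> D, satisfies psi v <-> P v.

Lemma qf_definable_ext n (P Q : ('I_n -> D) -> Prop) :
  (forall v, P v <-> Q v) -> qf_definable P -> qf_definable Q.
Proof. by move=> e [psi q h]; exists psi => // v; rewrite h. Qed.

Lemma qf_definable_lt n (t u : term n) :
  qf_definable (fun v : 'I_n -> D => sval (eval v t) < sval (eval v u)).
Proof. by exists (FLt t u). Qed.

Lemma qf_definable_const n (b : bool) : qf_definable (fun _ : 'I_n -> D => b).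
Proof.
case: b; first by exists (FEq TZero TZero).
by exists (FNot (FEq TZero TZero)) => // v /=; split => // /(_ erefl).
Qed.

Lemma qf_definable_not n (P : ('I_n -> D) -> Prop) :
  qf_definable P -> qf_definable (fun v => ~ P v).
Proof. by move=> [psi q h]; exists (FNot psi) => // v /=; rewrite h. Qed.

Lemma qf_definable_and n (P Q : ('I_n -> D) -> Prop) :
  qf_definable P -> qf_definable Q -> qf_definable (fun v => P v /\ Q v).
Proof. by move=> [p qp hp] [q qq hq]; exists (FAnd p q) => // v /=; rewrite hp hq. Qed.

Lemma qf_definable_or n (P Q : ('I_n -> D) -> Prop) :
  qf_definable P -> qf_definable Q -> qf_definable (fun v => P v \/ Q v).
Proof. by move=> [p qp hp] [q qq hq]; exists (FOr p q) => // v /=; rewrite hp hq. Qed.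

(* [F] is represented modulo 1 by a term, and its integer part has
   quantifier-free definable upper level sets. *)
Definition traceable n (F : ('I_n -> D) -> R) : Prop :=
  exists2 t : term n, (forall v, exists k : int, F v = sval (eval v t) + k%:~R) &
    forall m : int, qf_definable (fun v => m%:~R <= F v).

(** Here [k] is the integer part of [z + k], and an integer lies below a real exactly when it lies
    below the integer part. *)
Lemma le_frac_int (z : R) (m k : int) : 0 <= z < 1 -> (m%:~R <= z + k%:~R) = (m <= k).
Proof.
move=> /andP[z0 z1]; apply/idP/idP.
  by move=> h; rewrite -ltzD1 -(ltr_int R) intrD; lra.
by rewrite -(ler_int R); lra.
Qed.

Lemma traceable_ext n (F G : ('I_n -> D) -> R) :
  F =1 G -> traceable F -> traceable G.
Proof.
move=> e [t h d]; exists t => [v|m]; first by rewrite -e.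
by apply: qf_definable_ext (d m) => v; rewrite e.
Qed.

Lemma traceable_const n (c : int) : traceable (fun _ : 'I_n -> D => c%:~R).
Proof.
exists TZero => [v|m]; first by exists c; rewrite add0r.
exact: qf_definable_const.
Qed.

Lemma traceable_add n (F : ('I_n -> D) -> R) i :
  traceable F -> traceable (fun v => F v + vals v i).
Proof.
move=> [t hF dF]; pose t' := TAdd t (TVar i).
have carry v k : F v = sval (eval v t) + k%:~R ->
    F v + vals v i = sval (eval v t') +
      (k + (sval (eval v t') < sval (eval v t))%R%:Z)%:~R.
  move=> ->; rewrite /vals /= /add1 intrD.
  have /andP[] := D_bounds (eval v t); have /andP[] := D_bounds (v i).
  set a := sval (v i); set b := sval (eval v t) => a0 a1 b0 b1.
  case: ifP => ab.
    have -> /= : (b + a < b) = false by apply/negbTE; rewrite -leNgt; lra.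
    by lra.
  have -> /= : b + a - 1 < b by lra.
  by lra.
exists t' => [v|m].
  by have [k /carry->] := hF v; eexists.
(* The sum reaches [m] iff [F] already does, or [F] reaches [m - 1] and a carry occurs. *)
apply: qf_definable_ext (qf_definable_or (dF m)
  (qf_definable_and (dF (m - 1)) (qf_definable_lt t' t))) => v.
have [k e] := hF v; rewrite (carry _ _ e) e !le_frac_int ?D_bounds //.
rewrite lerBlDr; case: (_ < _); rewrite /= ?addr0; split.
- by case=> [mk|[]//]; rewrite (le_trans mk) // lerDl.
- by right.
- by case=> [//|[]].
- by left.
Qed.

Lemma traceable_sub n (F : ('I_n -> D) -> R) i :
  traceable F -> traceable (fun v => F v - vals v i).
Proof.
move=> [t hF dF]; pose t' := TAdd t (TOpp (TVar i)).
have borrow v k : F v = sval (eval v t) + k%:~R ->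
    F v - vals v i = sval (eval v t') +
      (k - (sval (eval v t) < sval (v i))%R%:Z)%:~R.
  move=> ->; rewrite /vals /= /add1 /opp1 intrD mulrNz.
  have /andP[] := D_bounds (eval v t); have /andP[] := D_bounds (v i).
  set a := sval (v i); set b := sval (eval v t) => a0 a1 b0 b1.
  (* The value 0 is separate because [opp1] sends it to 0 and not to 1; no borrow occurs then, as
     [b] is nonnegative. *)
  case: (eqVneq a 0) => [->|aN0].
    by rewrite (ltNge b 0) b0 addr0 b1 /=; lra.
  have {aN0}a0 : 0 < a by rewrite lt_def aN0.
  by case: (ltP b a) => ab; case: ltP => h /=; lra.
exists t' => [v|m].
  by have [k /borrow->] := hF v; eexists.
(* The difference reaches [m] iff [F] reaches [m + 1], or [F] reaches [m] and no borrow occurs. *)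
apply: qf_definable_ext (qf_definable_or (dF (m + 1))
  (qf_definable_and (dF m) (qf_definable_not (qf_definable_lt t (TVar i))))) => v.
have [k e] := hF v; rewrite (borrow _ _ e) e !le_frac_int ?D_bounds //=.
rewrite -lerBrDr; case: (_ < _); rewrite /= ?subr0; split.
- by case=> [//|[]].
- by left.
- by case=> [mk|[]//]; rewrite (le_trans mk) // gerBl.
- by right.
Qed.

Lemma traceable_mulz n (F : ('I_n -> D) -> R) i (k : int) :
  traceable F -> traceable (fun v => F v + vals v i *~ k).
Proof.
(* Since [Negz k] stands for $-(k+1)$, the induction for negative multiples starts with one
   subtraction. *)
move=> tF; case: k => k; elim: k => [|k ih].
- by apply: traceable_ext tF => v; rewrite mulr0z addr0.
- by apply: traceable_ext (traceable_add i ih) => v; rewrite -addrA -!pmulrn mulrSr.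
- by apply: traceable_ext (traceable_sub i tF) => v; rewrite NegzE mulrN1z.
- apply: traceable_ext (traceable_sub i ih) => v.
  by rewrite -addrA !NegzE !mulrNz -!pmulrn [in RHS]mulrSr opprD.
Qed.

Lemma traceable_affine n (f : affine n) : traceable (fun v => aff_eval f (vals v)).
Proof.
(* The index list of the sum is generalized, so that the form is built from its constant by adding
   one multiple of a variable at a time. *)
rewrite /aff_eval; elim: (index_enum _) => [|i r ih].
  by apply: traceable_ext (traceable_const n f.2) => v; rewrite big_nil add0r.
apply: traceable_ext (traceable_mulz i (f.1 i) ih) => v.
by rewrite big_cons addrC addrA.
Qed.

(** A weak constraint is the level set at 0. A strict one holds iff the form is at least 1, or is at
    least 0 with a positive representative modulo 1; the latter is what [TZero] below [t]
    expresses. *)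
Lemma qf_definable_csat n (p : constraint n) :
  qf_definable (fun v : 'I_n -> D => csat (vals v) p).
Proof.
case: p => s f; have [t hF dF] := traceable_affine f.
case: s; last exact: dF 0.
apply: qf_definable_ext (qf_definable_or (dF 1)
  (qf_definable_and (dF 0) (qf_definable_lt TZero t))) => v.
rewrite /csat /positive /=; have [k ->] := hF v.
have tb := D_bounds (eval v t); rewrite !le_frac_int //.
case/andP: tb; set a := sval _ => a0 a1; split.
  by rewrite -[1 <= k](ler_int R) -[0 <= k](ler_int R); case=> [|[]]; lra.
case: (ltgtP k 0) => [k0|k0|->]; last by rewrite addr0; right.
  (* A negative integer part is at most -1, which together with [a < 1] makes the form negative. *)
  suff : k%:~R <= -1 :> R by lra.
  by rewrite -[-1]/((-1)%:~R) ler_int -ltzD1 addrC subrr.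
by left.
Qed.

Lemma qf_definable_semilinear n (P : ('I_n -> R) -> bool) :
  semilinear P -> qf_definable (fun v => P (vals v)).
Proof.
move=> [ls h]; suff : qf_definable (fun v : 'I_n -> D => has (all (csat (vals v))) ls).
  by apply: qf_definable_ext => v; rewrite h.
elim: ls {h} => [|l ls ih] /=; first exact: (qf_definable_const _ false).
suff hl : qf_definable (fun v : 'I_n -> D => all (csat (vals v)) l).
  by apply: qf_definable_ext (qf_definable_or hl ih) => v; split=> /orP.
elim: l => [|p l ihl] /=; first exact: (qf_definable_const _ true).
apply: qf_definable_ext (qf_definable_and (qf_definable_csat p) ihl) => v.
by split=> /andP.
Qed.

End DefinableSets.

Lemma holds_universal_closure (M : L_structure) n (phi : formula n) :
  (forall v : 'I_n -> M, satisfies phi v) -> holds M (universal_closure phi).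
Proof. by elim: n phi => [//|n ih] phi h; apply: ih => v a; apply: h. Qed.

Theorem theorem5p2 (R : realType) : admits_QE (complete_theory (D R)).
Proof.
move=> n phi; have [P sP hP] := satisfies_semilinear R phi.
have [psi qf hpsi] := qf_definable_semilinear sP.
(* A sentence true in [D R] belongs to its complete theory and so holds in every model; it remains
   to check the equivalence in [D R] itself. *)
exists psi; split=> // M; apply; apply: holds_universal_closure => v /=.
by rewrite hP hpsi.
Qed.
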